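(* Let $P=\{x\in\mathbb{R}^n : Ax=b,\ Dx\le d\}$ be a $0/1$ polytope and consider the linear program $\max\{c^\top x : x\in P\}$, where $A,D,b,d,c$ are integral. From any initial vertex $x^0$ of $P$, the Slim Shadow rule reaches an optimal solution by performing at most $n$ steps.
   Context: A $0/1$ polytope is a polytope all of whose extreme points lie in $\{0,1\}^n$. Two vertices of $P$ are neighbors if they are joined by an edge of $P$. For a vertex $x$ of $P$ and $v\in\mathbb{R}^n$, $N_v(x)$ denotes the set of $v$-improving neighbors of $x$, i.e. neighbors $u$ with $v^\top u>v^\top x$. Slim Shadow rule. Given an initial vertex $x^0$ of $P$, let $v=\mathbf{1}-2x^0$ (fixed throughout). At a vertex $x^i$ that is not optimal for $c$, the rule moves in one step to a neighbor $$x^{i+1}\in\operatorname*{arg\,max}_{u\in N_v(x^i)}\frac{c^\top(u-x^i)}{v^\top(u-x^i)},$$ any maximizer being allowed when it is not unique. The rule stops upon reaching an optimal solution. *)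

(* Defs.v *)
From mathcomp Require Import all_boot all_order all_algebra.
From mathcomp Require Import all_classical all_reals all_analysis.
Set Implicit Arguments.
Unset Strict Implicit.
Unset Printing Implicit Defensive.
Import Order.TTheory GRing.Theory Num.Theory.
Import numFieldNormedType.Exports.
Local Open Scope classical_set_scope.
Local Open Scope ring_scope.

Section Polyhedra.
Variables (R : realType) (n : nat).
Implicit Types (P F : set 'cV[R]_n) (a c v x y z u w : 'cV[R]_n).

Definition dot a x : R := (a^T *m x) ord0 ord0.

Definition polyhedron p q (A : 'M[R]_(p, n)) (b : 'cV[R]_p)
    (D : 'M[R]_(q, n)) (d : 'cV[R]_q) : set 'cV[R]_n :=
  [set x | A *m x = b /\ forall i, (D *m x) i ord0 <= d i ord0].

Definition extreme_point P x : Prop :=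
  P x /\ forall y z (t : R), P y -> P z -> 0 < t < 1 ->
    x = t *: y + (1 - t) *: z -> y = x /\ z = x.

(* For a polyhedron [P], being a polytope means being bounded. *)
Definition zero_one_polytope P : Prop :=
  bounded_set P /\
  forall x, extreme_point P x -> forall i, x i ord0 = 0 \/ x i ord0 = 1.

Definition face P F : Prop :=
  exists a (beta : R), (forall x, P x -> dot a x <= beta) /\
    F = [set x | P x /\ dot a x = beta].

(* [F] has affine dimension [k]: it contains the [k + 1] affinely independent
   points [x], [x + col i B], and lies in their affine hull. *)
Definition has_affine_dim F (k : nat) : Prop :=
  exists x (B : 'M[R]_(n, k)),
    [/\ F x,
        \rank B = k,
        forall i, F (x + col i B) &
        forall y, F y -> exists t : 'cV[R]_k, y = x + B *m t].

Definition edge P F : Prop := face P F /\ has_affine_dim F 1.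

Definition neighbor P x u : Prop :=
  [/\ extreme_point P x, extreme_point P u, x != u &
      exists F, [/\ edge P F, F x & F u]].

Definition improving_neighbors P v x : set 'cV[R]_n :=
  [set u | neighbor P x u /\ dot v x < dot v u].

Definition optimal P c x : Prop := P x /\ forall y, P y -> dot c y <= dot c x.

Definition slim_direction (x0 : 'cV[R]_n) : 'cV[R]_n := const_mx 1 - 2 *: x0.

Definition slope c v x u : R := dot c (u - x) / dot v (u - x).

Definition slim_step P c v x u : Prop :=
  [/\ ~ optimal P c x,
      improving_neighbors P v x u &
      forall w, improving_neighbors P v x w -> slope c v x w <= slope c v x u].

(* [reaches_optimum_within P c v k x]: started at [x], the rule is never stuck
   at a non-optimal point and, whichever maximizer is chosen at each step, it is
   at an optimal solution after at most [k] steps. *)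
Inductive reaches_optimum_within P c v : nat -> 'cV[R]_n -> Prop :=
| ReachedOptimum k x : optimal P c x -> reaches_optimum_within P c v k x
| ReachByStep k x :
    (exists u, slim_step P c v x u) ->
    (forall u, slim_step P c v x u -> reaches_optimum_within P c v k u) ->
    reaches_optimum_within P c v k.+1 x.

(* The direction is determined by the initial vertex and never updated. *)
Definition slim_shadow_reaches_within P c (k : nat) x0 : Prop :=
  reaches_optimum_within P c (slim_direction x0) k x0.

End Polyhedra.

(* Main.v *)
(** For a 0/1 point [x], [v . (x - x0)] is the Hamming distance from [x0] to [x]:
    it is an integer at most [n], so there are at most [n] improving steps and it
    remains to see that the rule is not stuck before the optimum.  The invariant
    is that the current vertex maximizes [c - l v] for some [l >= 0].  It holds at
    [x0] for [l] the l1-norm of [c], and a step of maximal slope [l'] preserves it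
    with [l'] in place of [l].  If such a vertex is not optimal, then some edge
    improves [c], and along this edge [v] must increase. *)

Require Import Defs.
From mathcomp Require Import all_boot all_order all_algebra.
From mathcomp Require Import all_classical all_reals all_analysis.
From mathcomp Require Import ring lra.
Import Order.TTheory GRing.Theory Num.Theory.
Local Open Scope classical_set_scope.
Local Open Scope ring_scope.

Set Implicit Arguments.
Unset Strict Implicit.

(** * Bilinearity of the dot product *)

Section Dot.
Context {R : realType} {n : nat}.
Implicit Types (a x y : 'cV[R]_n).

Lemma dotE a x : dot a x = \sum_j a j ord0 * x j ord0.
Proof. by rewrite /dot mxE; apply: eq_bigr => j _; rewrite mxE. Qed.

Lemma dotDr a x y : dot a (x + y) = dot a x + dot a y.
Proof. by rewrite /dot mulmxDr mxE. Qed.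

Lemma dotZr a t x : dot a (t *: x) = t * dot a x.
Proof. by rewrite /dot -scalemxAr mxE. Qed.

Lemma dotNr a x : dot a (- x) = - dot a x.
Proof. by rewrite -scaleN1r dotZr mulN1r. Qed.

Lemma dotBr a x y : dot a (x - y) = dot a x - dot a y.
Proof. by rewrite dotDr dotNr. Qed.

Lemma dot0r a : dot a 0 = 0.
Proof. by rewrite -(scale0r 0) dotZr mul0r. Qed.

Lemma dotBl a b x : dot (a - b) x = dot a x - dot b x.
Proof. by rewrite /dot linearB /= mulmxBl !mxE. Qed.

Lemma dotZl a t x : dot (t *: a) x = t * dot a x.
Proof. by rewrite /dot linearZ /= -scalemxAl mxE. Qed.

Lemma dot_suml (I : finType) (S : pred I) (F : I -> 'cV[R]_n) x :
  dot (\sum_(i | S i) F i) x = \sum_(i | S i) dot (F i) x.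
Proof. by rewrite /dot linear_sum /= mulmx_suml summxE. Qed.

End Dot.

Lemma convex_comb_max {R : realFieldType} (x y r m : R) : 0 < r < 1 ->
  x <= m -> y <= m -> r * x + (1 - r) * y = m -> x = m /\ y = m.
Proof. by move=> /andP[r0 r1] xm ym e; split; nra. Qed.

(** * Vertices and improving edges of an intersection of finitely many half-spaces *)

Section ImprovingEdge.
Context {R : realType} {n : nat} {I : finType}.
Variables (a : I -> 'cV[R]_n) (g : I -> R).
Implicit Types (x y z h w : 'cV[R]_n).

Definition halfspaces : set 'cV[R]_n := [set x | forall i, dot (a i) x <= g i].

(* A direction of the pointed cone [a i . z <= 0, i in S] with the largest set
   of tight constraints among those with [w . z > 0] spans a ray. *)
Lemma improving_ray (S : pred I) w z :
    (forall h, (forall i, S i -> dot (a i) h = 0) -> h = 0) ->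
    (forall i, S i -> dot (a i) z <= 0) -> 0 < dot w z ->
  exists2 z', (forall i, S i -> dot (a i) z' <= 0) /\ 0 < dot w z' &
    forall h, (forall i, S i -> dot (a i) z' = 0 -> dot (a i) h = 0) ->
      exists t, h = t *: z'.
Proof.
move=> pointed.
have [k] := ubnP #|[pred i | S i && (dot (a i) z != 0)]|.
elim: k z => // k IH z; rewrite ltnS => card_le zC wz.
have [ray|] := pselect (forall h,
  (forall i, S i -> dot (a i) z = 0 -> dot (a i) h = 0) -> exists t, h = t *: z).
  by exists z.
move=> /existsNP[h0 /not_implyP[h0L h0z]].
(* Removing a multiple of [z] makes the direction orthogonal to [w], so moving along it preserves
   [w . z > 0]; it is nonzero because [h0] is off the line of [z]. *)
pose h := h0 - (dot w h0 / dot w z) *: z.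
have h_neq0 : h != 0.
  apply/eqP => /eqP; rewrite subr_eq0 => /eqP e.
  by apply: h0z; exists (dot w h0 / dot w z).
have wh : dot w h = 0 by rewrite dotBr dotZr divfK ?subrr// gt_eqF.
have hL i : S i -> dot (a i) z = 0 -> dot (a i) h = 0.
  by move=> Si zi; rewrite dotBr dotZr zi mulr0 subr0 h0L.
have [h' [wh' hL' [i0 Si0 hi0]]] : exists h', [/\ dot w h' = 0,
    (forall i, S i -> dot (a i) z = 0 -> dot (a i) h' = 0) &
    exists2 i, S i & 0 < dot (a i) h'].
  have [i Si hi] : exists2 i, S i & dot (a i) h != 0.
    apply: contrapT => noi; case/eqP: h_neq0; apply: pointed => i Si.
    by apply: contrapT => /eqP hi; apply: noi; exists i.
  case: (ltgtP 0 (dot (a i) h)) hi => // hi _.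
    by exists h; split => //; exists i.
  exists (- h); split; first by rewrite dotNr wh oppr0.
    by move=> j Sj zj; rewrite dotNr hL ?oppr0.
  by exists i; rewrite // dotNr oppr_gt0.
(* Ratio test: [z] moves along [h'] until a first constraint [j] becomes tight. Constraints tight at
   [z] stay tight, so the number of slack ones drops. *)
pose T := [pred i | S i && (0 < dot (a i) h')].
pose ratio i := - dot (a i) z / dot (a i) h'.
have Ti0 : T i0 by rewrite /= Si0.
case: (arg_minP ratio Ti0) => j /andP[Sj hj] jmin.
have ratio_ge0 : 0 <= ratio j.
  by rewrite divr_ge0 ?oppr_ge0 ?zC// ltW.
have zj : dot (a j) z != 0.
  by apply/eqP => /(hL' _ Sj) e; rewrite e ltxx in hj.
apply: (IH (z + ratio j *: h')).
- apply: leq_trans card_le; apply: proper_card; apply/properP; split.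
    apply/fintype.subsetP => i; rewrite !inE => /andP[Si]; rewrite Si /=.
    by apply: contra => /eqP zi; rewrite dotDr dotZr zi hL'// mulr0 addr0.
  exists j; rewrite !inE Sj //= dotDr dotZr divfK ?subrr ?eqxx//.
  by rewrite gt_eqF.
- move=> i Si; rewrite dotDr dotZr.
  have [hi|hi] := ltP 0 (dot (a i) h').
    have := jmin i; rewrite inE Si hi => /(_ isT).
    by rewrite {2}/ratio ler_pdivlMr//; lra.
  by have := zC i Si; have := mulr_ge0_le0 ratio_ge0 hi; lra.
- by rewrite dotDr dotZr wh' mulr0 addr0.
Qed.

(** The ratio test of the simplex method. The smallest ratio is positive because no constraint tight
    at [x] increases along [z]. *)
Lemma first_exit x z i0 : halfspaces x ->
    (forall i, dot (a i) x = g i -> dot (a i) z <= 0) -> 0 < dot (a i0) z ->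
  exists t, [/\ 0 < t, halfspaces (x + t *: z) &
    exists2 j, 0 < dot (a j) z & dot (a j) (x + t *: z) = g j].
Proof.
move=> Px zC hi0; pose ratio i := (g i - dot (a i) x) / dot (a i) z.
case: (@arg_minP _ _ _ i0 [pred i | 0 < dot (a i) z] ratio hi0) => j /= hj jmin.
have ratio_gt0 : 0 < ratio j.
  rewrite divr_gt0// subr_gt0 lt_neqAle Px andbT.
  by apply/eqP => /zC; rewrite leNgt hj.
exists (ratio j); split => //; last first.
  by exists j => //; rewrite dotDr dotZr divfK ?gt_eqF// addrC subrK.
move=> i; rewrite dotDr dotZr.
have [hi|hi] := ltP 0 (dot (a i) z).
  by have := jmin i hi; rewrite {2}/ratio ler_pdivlMr//; lra.
by have := Px i; have := mulr_ge0_le0 (ltW ratio_gt0) hi; lra.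
Qed.

Lemma feasible_step x z : halfspaces x ->
    (forall i, dot (a i) x = g i -> dot (a i) z <= 0) ->
  exists2 t, 0 < t & halfspaces (x + t *: z).
Proof.
move=> Px zC; have [[i hi]|noi] := pselect (exists i, 0 < dot (a i) z).
  by have [t [t0 Pt _]] := first_exit Px zC hi; exists t.
exists 1 => // i; rewrite dotDr dotZr mul1r.
have : dot (a i) z <= 0 by rewrite leNgt; apply/negP => ?; apply: noi; exists i.
by have := Px i; lra.
Qed.

(** Both [h] and [- h] are feasible directions at [x], so a nonzero [h] would put [x] strictly
    inside a segment of the polyhedron. *)
Lemma extreme_pointed x h : extreme_point halfspaces x ->
  (forall i, dot (a i) x = g i -> dot (a i) h = 0) -> h = 0.
Proof.
move=> [Px xext] h0.
have [i /h0->//|s s0 Ps] := feasible_step (z := h) Px.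
have [i /h0|t t0 Pt] := feasible_step (z := - h) Px.
  by rewrite dotNr => ->; rewrite oppr0.
have st0 : s + t != 0 by rewrite gt_eqF// addr_gt0.
have [||+ _] := xext _ _ (t / (s + t)) Ps Pt.
- by rewrite divr_gt0 ?addr_gt0//= ltr_pdivrMr ?addr_gt0// mul1r ltrDr.
- by apply/colP => i; rewrite !mxE; field.
- move=> /eqP; rewrite -subr_eq0 addrAC subrr add0r scaler_eq0 gt_eqF//=.
  by move/eqP.
Qed.

Lemma bounded_exit x z : bounded_set halfspaces -> halfspaces x -> z != 0 ->
  exists i, 0 < dot (a i) z.
Proof.
move=> /(pinfty_ex_gt0) [M M0 bM] Px z0; apply: contrapT => noi.
have zle i : dot (a i) z <= 0.
  by rewrite leNgt; apply/negP => ?; apply: noi; exists i.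
have z_gt0 : 0 < `|z| by rewrite normr_gt0.
(* Chosen so that [t *: z] is longer than [M] plus the norm of [x], contradicting the bound [M] at
   [x + t *: z]. *)
pose t := (M + `|x| + 1) / `|z|.
have t0 : 0 <= t by rewrite divr_ge0// !addr_ge0// ltW.
have /bM /= le1 : halfspaces (x + t *: z).
  move=> i; rewrite dotDr dotZr.
  by have := Px i; have := mulr_ge0_le0 t0 (zle i); lra.
have : `|t *: z| <= M + `|x|.
  have -> : t *: z = (x + t *: z) - x by rewrite addrC addKr.
  by apply: le_trans (ler_normB _ _) _; rewrite lerD2r.
by rewrite normrZ ger0_norm// divfK ?gt_eqF//; lra.
Qed.

(** The cone of feasible directions at [x] is pointed and contains an improving direction [y - x],
    hence an improving ray [z]. Boundedness stops this ray at a point [u], the neighbor. *)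
Lemma improving_neighbor x w : bounded_set halfspaces ->
    extreme_point halfspaces x -> ~ optimal halfspaces w x ->
  exists2 u, neighbor halfspaces x u & dot w x < dot w u.
Proof.
move=> bP xext nopt; have [Px _] := xext.
have [y Py wy] : exists2 y, halfspaces y & dot w x < dot w y.
  apply: contrapT => noy; apply: nopt; split => // y Py.
  by rewrite leNgt; apply/negP => ?; apply: noy; exists y.
pose S := [pred i | dot (a i) x == g i].
have [h hS|i /eqP xi||z [zC wz] zray] := @improving_ray S w (y - x).
- by apply: (extreme_pointed xext) => i /eqP; exact: hS.
- by rewrite dotBr xi subr_le0.
- by rewrite dotBr subr_gt0.
have z0 : z != 0 by apply/eqP => z0; rewrite z0 dot0r ltxx in wz.
have [i0 zi0] := bounded_exit bP Px z0.
have [i /eqP/zC//|t [t0 Pu [j zj uj]]] := first_exit Px _ zi0.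
set u := x + t *: z in Pu uj.
pose T := [pred i | S i && (dot (a i) z == 0)].
(* The sum of the constraints tight along the whole ray: it reaches [beta] only where each of them
   is tight, hence only on the line through [x] and [u]. *)
pose b := \sum_(i | T i) a i; pose beta := \sum_(i | T i) g i.
have b_le y' : halfspaces y' -> dot b y' <= beta.
  by move=> Py'; rewrite dot_suml; apply: ler_sum => i _; exact: Py'.
have bxz s : dot b (x + s *: z) = beta.
  rewrite dot_suml; apply: eq_bigr => i /andP[/eqP xi /eqP zi].
  by rewrite dotDr dotZr zi mulr0 addr0.
have line y' : halfspaces y' -> dot b y' = beta -> exists s, y' = x + s *: z.
  move=> Py' by'; have [|s hs] := zray (y' - x); last first.
    by exists s; rewrite -hs addrC subrK.
  move=> i Si zi; have /eqP xi := Si; rewrite dotBr xi; apply/eqP.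
  rewrite -oppr_eq0 opprB; apply/eqP.
  apply: (@psumr_eq0P _ _ T (fun i => g i - dot (a i) y')).
  - by move=> k _; rewrite subr_ge0; exact: Py'.
  - by rewrite sumrB -/beta -by' dot_suml subrr.
  - by rewrite inE /= xi zi !eqxx.
have uext : extreme_point halfspaces u.
  split=> // y1 y2 r P1 P2 r01 eu.
  have [b1 b2] : dot b y1 = beta /\ dot b y2 = beta.
    apply: (convex_comb_max r01) (b_le _ P1) (b_le _ P2) _.
    by rewrite -!dotZr -dotDr -eu bxz.
  have [j1 j2] : dot (a j) y1 = g j /\ dot (a j) y2 = g j.
    by apply: (convex_comb_max r01) (P1 j) (P2 j) _; rewrite -!dotZr -dotDr -eu.
  (* The blocking constraint [j] strictly increases along [z], so it is tight at a single point of
     the line. *)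
  have hit y' : halfspaces y' -> dot b y' = beta -> dot (a j) y' = g j -> y' = u.
    move=> Py' /(line _ Py')[s ->]; rewrite -uj !dotDr !dotZr => /addrI/mulIf.
    by move=> -> //; rewrite gt_eqF.
  by split; apply: hit.
have tz0 : t *: z != 0 by rewrite scaler_eq0 gt_eqF.
exists u; last by rewrite dotDr dotZr ltrDl mulr_gt0.
split => //; first by rewrite eq_sym -subr_eq0 addrAC subrr add0r.
have Fx : dot b x = beta by rewrite -(bxz 0) scale0r addr0.
exists [set y' | halfspaces y' /\ dot b y' = beta]; split => //; last first.
  by split => //; exact: bxz.
split; first by exists b, beta; split.
exists x, (t *: z); split => //.
- by rewrite -mxrank_tr rank_rV trmx_eq0 tz0.
- move=> i; have -> : col i (t *: z) = t *: z.
    by apply/colP => k; rewrite mxE (ord1 i).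
  by split => //; exact: bxz.
- move=> y' [Py' /(line _ Py')[s ->]]; exists (const_mx (s / t)).
  congr (_ + _); apply/colP => k; rewrite !mxE big_ord1 !mxE.
  by field; rewrite gt_eqF.
Qed.

End ImprovingEdge.

(** * The Slim Shadow rule on a set with 0/1 vertices and improving edges *)

Section SlimShadow.
Context {R : realType} {n : nat}.
Variable P : set 'cV[R]_n.
Hypothesis P01 : forall x, extreme_point P x ->
  forall i, x i ord0 = 0 \/ x i ord0 = 1.
Hypothesis P_edge : forall x w, extreme_point P x -> ~ optimal P w x ->
  exists2 u, neighbor P x u & dot w x < dot w u.
Implicit Types (c v x u w : 'cV[R]_n).

(** Neighbors are 0/1 points, so the maximum can be taken over the finite type of boolean
    vectors. *)
Lemma slope_max_exists c v x u : improving_neighbors P v x u ->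
  exists2 u', improving_neighbors P v x u' &
    forall w, improving_neighbors P v x w -> slope c v x w <= slope c v x u'.
Proof.
pose emb (s : 'cV[bool]_n) : 'cV[R]_n := map_mx (fun b : bool => b%:R) s.
have embP w : improving_neighbors P v x w -> exists s, w = emb s.
  move=> [[_ /P01 w01 _ _] _]; exists (map_mx (fun r => r == 1) w).
  apply/colP => i; rewrite !mxE.
  by case: (w01 i) => ->; rewrite ?eqxx// eq_sym oner_eq0.
move=> ux; have [s us] := embP u ux.
have Ts : `[< improving_neighbors P v x (emb s) >] by rewrite -us; apply/asboolP.
case: (@arg_maxP _ _ _ s (fun s => `[< improving_neighbors P v x (emb s) >])
  (fun s => slope c v x (emb s)) Ts) => s' /asboolP s'x smax.
exists (emb s') => // w wx; have [sw ew] := embP w wx.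
by rewrite ew; apply: smax; apply/asboolP; rewrite -ew.
Qed.

(** Optimality for [c - l v] bounds the gain in [c] along an edge by [l] times the gain in [v], so
    an edge improving [c] also improves [v]. *)
Lemma positive_slope_neighbor c v l x : extreme_point P x -> 0 <= l ->
    optimal P (c - l *: v) x -> ~ optimal P c x ->
  exists2 w, improving_neighbors P v x w & 0 < slope c v x w.
Proof.
move=> xext l0 [_ lopt] nopt; have [w xw cw] := P_edge xext nopt.
have [_ [Pw _] _ _] := xw; have := lopt w Pw.
rewrite !dotBl !dotZl => le_w.
have vw : dot v x < dot v w.
  rewrite ltNge; apply/negP => vw.
  by have := ler_wpM2l l0 vw; lra.
by exists w; rewrite // /slope !dotBr divr_gt0// subr_gt0.
Qed.

Lemma slim_step_ex c v l x : extreme_point P x -> 0 <= l ->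
    optimal P (c - l *: v) x -> ~ optimal P c x ->
  exists u, slim_step P c v x u.
Proof.
move=> xext l0 lopt nopt.
have [w vw _] := positive_slope_neighbor xext l0 lopt nopt.
by have [u vu umax] := slope_max_exists c vw; exists u; split.
Qed.

(* Parametric optimality: a steepest pivot from a maximizer of [c - l v] leads to
   a maximizer of [c - l' v], where [l'] is the slope of the pivot. *)
Lemma slim_step_optimal c v l x u : extreme_point P x -> 0 <= l ->
    optimal P (c - l *: v) x -> slim_step P c v x u ->
  exists2 l', 0 <= l' & optimal P (c - l' *: v) u.
Proof.
move=> xext l0 lopt [nopt [xu vu] umax].
have [w0 vw0 sw0] := positive_slope_neighbor xext l0 lopt nopt.
have [Px lmax] := lopt; have [_ [Pu _] _ _] := xu.
set l' := slope c v x u in umax.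
exists l'; first exact: le_trans (ltW sw0) (umax _ vw0).
have cu : dot c u - dot c x = l' * (dot v u - dot v x).
  by rewrite /l' /slope !dotBr divfK// gt_eqF// subr_gt0.
(* By the choice of [l'], the objective [c - l' v] takes the same value at [x] and at [u]. *)
suff [_ xmax] : optimal P (c - l' *: v) x.
  split => // y /xmax; rewrite !dotBl !dotZl => H.
  by apply: le_trans H _; lra.
apply: contrapT => /(P_edge xext)[w xw].
have [_ [Pw _] _ _] := xw.
have := lmax _ Pw; have := lmax _ Pu; rewrite !dotBl !dotZl => le_u le_w lt_w.
(* If [v] increases towards [w], the slope of [w] exceeds the maximal slope [l']. Otherwise
   [l' <= l], and [w] would also improve [c - l v]. *)
have [vw|vw] := ltP (dot v x) (dot v w).
  have := umax w (conj xw vw); rewrite {1}/slope !dotBr ler_pdivrMr ?subr_gt0//.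
  lra.
have l'l : l' <= l.
  have d0 : 0 < dot v u - dot v x by rewrite subr_gt0.
  by rewrite -(ler_pM2r d0); lra.
have : l * (dot v w - dot v x) <= l' * (dot v w - dot v x).
  by apply: ler_wnM2r => //; rewrite subr_le0.
lra.
Qed.

(** The direction is 1 where [x0] is 0 and -1 where [x0] is 1, so [e] is the contribution of
    coordinate [i] to the Hamming distance. *)
Lemma slim_direction_coord x0 x i : extreme_point P x0 -> extreme_point P x ->
  let e := slim_direction x0 i ord0 * (x - x0) i ord0 in
  0 <= e <= 1 /\ `|(x - x0) i ord0| = e.
Proof.
move=> /P01/(_ i) x0i /P01/(_ i) xi; rewrite !mxE.
case: x0i => ->; case: xi => ->;
  (split; [apply/andP; split; lra|]);
  rewrite ?subrr ?subr0 ?sub0r ?normrN ?normr0 ?normr1; lra.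
Qed.

Lemma dot_direction_int x0 x : extreme_point P x0 -> extreme_point P x ->
  dot (slim_direction x0) x \is a Num.int.
Proof.
move=> /P01 h0 /P01 h; rewrite dotE; apply: rpred_sum => i _.
have int01 (r : R) : r = 0 \/ r = 1 -> r \is a Num.int by case=> ->.
rewrite !mxE; apply: rpredM; last exact/int01.
by apply: rpredB; rewrite ?rpred1// rpredM ?rpred_nat//; exact/int01.
Qed.

(** Induction on the budget [k], which is kept at least [n] minus the Hamming distance from [x0] to
    [x]. *)
Lemma slim_reaches c v x0 (k : nat) x l :
    v = slim_direction x0 -> extreme_point P x0 -> extreme_point P x ->
    0 <= l -> optimal P (c - l *: v) x ->
    dot v x0 + n%:R <= dot v x + k%:R ->
  reaches_optimum_within P c v k x.
Proof.
move=> vE x0ext; have v_le u : extreme_point P u -> dot v u <= dot v x0 + n%:R.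
  move=> uext; rewrite -lerBlDl -dotBr dotE -[n in n%:R]card_ord -sum1_card natr_sum.
  by apply: ler_sum => i _; rewrite vE;
    have [/andP[]] := slim_direction_coord i x0ext uext.
elim: k x l => [|k IH] x l xext l0 lopt vx.
  (* With no budget left, [v] is already at its upper bound on vertices, so no [v]-improving step
     exists. *)
  apply: ReachedOptimum; apply: contrapT => nopt.
  have [u [_ [[_ uext _ _] vu] _]] := slim_step_ex xext l0 lopt nopt.
  by have := v_le u uext; lra.
have [opt|nopt] := pselect (optimal P c x); first exact: ReachedOptimum.
apply: ReachByStep; first exact: slim_step_ex lopt nopt.
move=> u xu; have [l' l'0 uopt] := slim_step_optimal xext l0 lopt xu.
have [_ [[_ uext _ _] vu] _] := xu.
apply: (IH u l') => //.
(* A positive integer is at least 1, so each step pays for one unit of budget. *)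
suff : 1 <= dot v u - dot v x by rewrite -natr1 in vx *; lra.
have d0 : 0 < dot v u - dot v x by rewrite subr_gt0.
rewrite -(gtr0_norm d0); apply: norm_intr_ge1; last by rewrite gt_eqF.
by rewrite vE rpredB ?dot_direction_int.
Qed.

(** At a vertex [u], each coordinate of [u - x0] is at most the Hamming distance in absolute value,
    so [c] gains at most its l1-norm times that distance. Testing neighbors suffices by [P_edge]. *)
Lemma initial_optimal c x0 : extreme_point P x0 ->
  optimal P (c - (\sum_j `|c j ord0|) *: slim_direction x0) x0.
Proof.
move=> x0ext; apply: contrapT => /(P_edge x0ext)[u [_ uext _ _]].
rewrite !dotBl !dotZl; set l := \sum_j _; set v := slim_direction x0.
suff : dot c (u - x0) <= l * dot v (u - x0) by rewrite !dotBr; lra.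
pose e j := v j ord0 * (u - x0) j ord0.
have e0 j : 0 <= e j by have [/andP[]] := slim_direction_coord j x0ext uext.
rewrite dotE mulr_suml; apply: ler_sum => j _.
apply: le_trans (ler_norm _) _; rewrite normrM ler_wpM2l//.
have [_ ->] := slim_direction_coord j x0ext uext.
rewrite dotE -/(e j) (bigD1 j)//= lerDl.
by apply: sumr_ge0 => i _; exact: e0.
Qed.

End SlimShadow.

(** * Equations as pairs of opposite inequalities, and the conclusion *)

Lemma polyhedron_halfspaces {R : realType} {n p q : nat} (A : 'M[R]_(p, n)) b
    (D : 'M[R]_(q, n)) d :
  polyhedron A b D d = halfspaces
    (fun i : 'I_q + ('I_p + 'I_p) => match i with
      | inl i => (row i D)^T | inr (inl i) => (row i A)^T
      | inr (inr i) => - (row i A)^T end)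
    (fun i => match i with
      | inl i => d i ord0 | inr (inl i) => b i ord0
      | inr (inr i) => - b i ord0 end).
Proof.
have rowE m (M : 'M[R]_(m, n)) i x : dot (row i M)^T x = (M *m x) i ord0.
  by rewrite /dot trmxK -row_mul mxE.
have rowNE m (M : 'M[R]_(m, n)) i x : dot (- (row i M)^T) x = - (M *m x) i ord0.
  by rewrite -scaleN1r dotZl rowE mulN1r.
apply/seteqP; split => x /=.
  by move=> [Ax Dx] [i|[i|i]]; rewrite ?rowE ?rowNE ?Ax.
move=> H; split; last by move=> i; have := H (inl i); rewrite rowE.
apply/colP => i; apply/eqP; rewrite eq_le.
have := H (inr (inl i)); have := H (inr (inr i)); rewrite rowE rowNE lerN2.
by move=> -> ->.
Qed.

Theorem theorem5 (R : realType) (n p q : nat)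
  (A : 'M[int]_(p, n)) (b : 'cV[int]_p) (D : 'M[int]_(q, n)) (d : 'cV[int]_q)
  (c : 'cV[int]_n) (P : set 'cV[R]_n)
  (hP : P = polyhedron (map_mx intr A) (map_mx intr b)
                       (map_mx intr D) (map_mx intr d))
  (h01 : zero_one_polytope P)
  (x0 : 'cV[R]_n) (hx0 : extreme_point P x0) :
  slim_shadow_reaches_within P (map_mx intr c) n x0.
Proof.
have [bP P01] := h01.
have P_edge x w : extreme_point P x -> ~ optimal P w x ->
    exists2 u, neighbor P x u & dot w x < dot w u.
  rewrite hP polyhedron_halfspaces in bP *; exact: improving_neighbor.
(* At [x0] the distance covered is 0, so the budget condition holds with equality for [n] steps. *)
apply: (slim_reaches P01 P_edge) (initial_optimal P01 P_edge _ hx0) _ => //.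
exact: sumr_ge0.
Qed.
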